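(* Consider the discounted LQG problem with data $(A,B,W,\nu_0,Q_0,R_0,\alpha)$ and the infinite dimensional linear program (D-SC) described in the context. Let $\hat{\mathcal F}(\mathbb R^n)$ be the set of functions $v(x)=x^TPx+q^Tx+r$ with $P\in\mathcal S^n$, $q\in\mathbb R^n$, $r\in\mathbb R$. Restricting the variable $v$ of (D-SC) from $\mathcal F(\mathbb R^n)$ to $\hat{\mathcal F}(\mathbb R^n)$ yields the following semidefinite program (D-LQG) in the variables $P\in\mathcal S^n$, $q\in\mathbb R^n$, $r\in\mathbb R$, which is therefore a restriction of (D-SC): $$\max\ \operatorname{Tr}(P\Sigma_0)+\operatorname{Tr}(Pm_0m_0^T)+q^Tm_0+r\quad\text{s.t.}\quad \begin{bmatrix} s_0&s_1^T&s_2^T\\ s_1&S_{11}&S_{12}\\ s_2&S_{12}^T&S_{22}\end{bmatrix}\succeq0,$$ where $$s_0=r(\alpha-1)+\alpha\operatorname{Tr}(PW),\qquad s_1=\tfrac12(-I+\alpha A^T)q,\qquad s_2=\tfrac{\alpha}{2}B^Tq,$$ $$\begin{bmatrix}S_{11}&S_{12}\\S_{12}^T&S_{22}\end{bmatrix}=\begin{bmatrix}\alpha A^TPA-P+Q_0&\alpha A^TPB\\ \alpha B^TPA&R_0+\alpha B^TPB\end{bmatrix}.$$ That is, for $v(x)=x^TPx+q^Tx+r$, $v$ is feasible for (D-SC) if and only if $(P,q,r)$ is feasible for (D-LQG), and $\langle v,\nu_0\rangle$ equals the objective of (D-LQG) at $(P,q,r)$. Furthermore, (D-LQG) is the Lagrangian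 dual of the semidefinite program (P-LQG) given in the context (with $P,q,r$ the multipliers of (C2), (C1), (C0) respectively).
   Context: Setting. $x_{t+1}=Ax_t+Bu_t+\omega_t$ with $x_t\in\mathbb R^n$, $u_t\in\mathbb R^m$, $\omega_t$ i.i.d. Gaussian with mean $0$ and covariance $W$; the initial state $x_0$ is independent of the noise and has distribution $\nu_0$ (a probability measure on $\mathbb R^n$ with finite second moments), with mean $m_0$ and covariance $\Sigma_0=E[(x_0-m_0)(x_0-m_0)^T]$. $\mathcal S^n$, $\mathcal S^n_+$, $\mathcal S^n_{++}$ denote the real symmetric, symmetric positive semidefinite and symmetric positive definite $n\times n$ matrices. $Q_0=C^TC\in\mathcal S^n_+$, $R_0\in\mathcal S^m_{++}$, $(A,B)$ is controllable, $(A,C)$ is observable, and $\alpha\in(0,1)$. The running cost is $c_0(x,u)=x^TQ_0x+u^TR_0u$. The transition kernel $\tau(\cdot|x,u)$ is the Gaussian law with mean $Ax+Bu$ and covariance $W$. $\mathcal F(\mathbb R^n)$ is the space of real measurable functions on $\mathbb R^n$ growing at most quadratically. For $v\in\mathcal F(\mathbb R^n)$, $[T^*v](x,u)=v(x)-\alpha\int_{\mathbb R^n}v(y)\,\tau(dy|x,u)$, and $\langle v,\nu_0\rangle=\int v\,d\nu_0$. Program (D-SC): maximize $\langle v,\nu_0\rangle$ over $v\in\mathcal F(\mathbb R^n)$ subject to $c_0(x,u)-[T^*v](x,u)\ge0$ for all $(x,u)\in\mathbb R^n\times\mathbb R^m$. Program (P-LQG): minimize $\operatorname{Tr}(Q_0Z_{xx})+\operatorname{Tr}(R_0Z_{uu})$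 over $m\in\mathbb R$, $m_x\in\mathbb R^n$, $m_u\in\mathbb R^m$, $Z_{xx}\in\mathcal S^n$, $Z_{xu}\in\mathbb R^{n\times m}$, $Z_{uu}\in\mathcal S^m$ subject to (C2) $\Sigma_0+m_0m_0^T-Z_{xx}+\alpha(AZ_{xx}A^T+AZ_{xu}B^T+BZ_{xu}^TA^T+BZ_{uu}B^T+mW)=0$; (C1) $m_0-m_x+\alpha(Am_x+Bm_u)=0$; (C0) $\alpha m-m+1=0$; (Cp) $Z=\begin{bmatrix} m& m_x^T& m_u^T\\ m_x&Z_{xx}&Z_{xu}\\ m_u&Z_{xu}^T&Z_{uu}\end{bmatrix}\succeq 0$. Lagrangian dual of (P-LQG): maximize over $(P,q,r)\in\mathcal S^n\times\mathbb R^n\times\mathbb R$ the infimum over all $Z\succeq0$ of $\operatorname{Tr}(Q_0Z_{xx})+\operatorname{Tr}(R_0Z_{uu})+\operatorname{Tr}(P\,\ell_2)+q^T\ell_1+r\,\ell_0$, where $\ell_2,\ell_1,\ell_0$ denote the left-hand sides of (C2), (C1), (C0); the value $-\infty$ encodes dual infeasibility. *)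

(* Defs.v *)
From HB Require Import structures.
From mathcomp Require Import all_boot all_order all_algebra.
From mathcomp Require Import all_classical all_reals all_analysis.
Set Implicit Arguments.
Unset Strict Implicit.
Unset Printing Implicit Defensive.
Import Order.TTheory GRing.Theory Num.Theory.
Import numFieldNormedType.Exports.
Local Open Scope classical_set_scope.
Local Open Scope ring_scope.

(* Elements of R^n are column vectors. *)

Section Matrices.
Context {R : realType}.

Definition dotv n (a x : 'cV[R]_n) : R := (a^T *m x) 0 0.

Definition qform n (M : 'M[R]_n) (x : 'cV[R]_n) : R := (x^T *m M *m x) 0 0.

Definition symm n (M : 'M[R]_n) : Prop := M^T = M.

Definition psd n (M : 'M[R]_n) : Prop := symm M /\ forall x, 0 <= qform M x.

Definition pd n (M : 'M[R]_n) : Prop :=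
  symm M /\ forall x, x != 0 -> 0 < qform M x.

(* [B, AB, ..., A^(n-1) B] has full row rank. *)
Definition controllable n m (A : 'M[R]_n) (B : 'M[R]_(n, m)) : Prop :=
  \rank (\mxrow_(k < n) (A ^+ k *m B)) = n.

Definition observable n p (A : 'M[R]_n) (C : 'M[R]_(p, n)) : Prop :=
  controllable A^T C^T.

Definition block3 n m (s0 : R) (s1 : 'cV[R]_n) (s2 : 'cV[R]_m)
    (S11 : 'M[R]_n) (S12 : 'M[R]_(n, m)) (S22 : 'M[R]_m)
    : 'M[R]_(1 + (n + m)) :=
  block_mx s0%:M (row_mx s1^T s2^T)
           (col_mx s1 s2) (block_mx S11 S12 S12^T S22).

End Matrices.

(* R^n with its Borel sigma-algebra. *)
Definition borelV (R : realType) (n : nat) :=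
  g_sigma_algebraType (@open 'cV[R]_n).

Section Laws.
Context {R : realType}.

(* The univariate Gaussian law with mean [mu] and variance [s2]. The library's
   [normal_prob] takes the standard deviation and is not a point mass when it
   is 0, hence the separate degenerate case. *)
Definition normal_law (mu s2 : R) (E : set (measurableTypeR R)) : \bar R :=
  if s2 == 0 then dirac mu E else normal_prob mu (Num.sqrt s2) E.

(* The Gaussian law on R^n with mean [mu] and (possibly singular) covariance
   [W], characterised by its one-dimensional projections: <a, Y> is
   N(<a, mu>, a^T W a) for every [a]. *)
Definition gaussian_law n (P : probability (borelV R n) R)
    (mu : 'cV[R]_n) (W : 'M[R]_n) : Prop :=
  forall (a : 'cV[R]_n) (E : set (measurableTypeR R)), measurable E ->
    P [set y | E (dotv a y)] = normal_law (dotv a mu) (qform W a) E.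

Definition finite_second_moments n (nu : probability (borelV R n) R) : Prop :=
  (\int[nu]_x (dotv x x)%:E < +oo)%E.

Definition meanV n (nu : probability (borelV R n) R) : 'cV[R]_n :=
  \col_i (\int[nu]_x (x : 'cV[R]_n) i 0)%R.

Definition covV n (nu : probability (borelV R n) R) : 'M[R]_n :=
  \matrix_(i, j) (\int[nu]_x (((x : 'cV[R]_n) i 0 - meanV nu i 0) *
                              ((x : 'cV[R]_n) j 0 - meanV nu j 0)))%R.

End Laws.

Section InfiniteLP.
Context {R : realType} (n m : nat).
Variables (tau : 'cV[R]_n -> 'cV[R]_m -> probability (borelV R n) R)
          (nu0 : probability (borelV R n) R)
          (Q0 : 'M[R]_n) (R0 : 'M[R]_m) (alpha : R).

Definition quad_growth : set ('cV[R]_n -> R) :=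
  [set v | measurable_fun [set: borelV R n] (v : borelV R n -> R) /\
           exists K : R, forall x, `|v x| <= K * (1 + dotv x x)].

Definition cost0 (x : 'cV[R]_n) (u : 'cV[R]_m) : R := qform Q0 x + qform R0 u.

Definition Tstar (v : 'cV[R]_n -> R) (x : 'cV[R]_n) (u : 'cV[R]_m) : R :=
  v x - alpha * (\int[tau x u]_y v y)%R.

Definition dsc_obj (v : 'cV[R]_n -> R) : R := (\int[nu0]_x v x)%R.

Definition dsc_feasible : set ('cV[R]_n -> R) :=
  [set v | quad_growth v /\ forall x u, 0 <= cost0 x u - Tstar v x u].

(* Optimal value of the infinite-dimensional program (D-SC) when its variable
   is restricted to [V]; (D-SC) itself is the case [V = quad_growth]. *)
Definition dsc_value (V : set ('cV[R]_n -> R)) : \bar R :=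
  ereal_sup [set (dsc_obj v)%:E | v in V `&` dsc_feasible].

End InfiniteLP.

Definition quadratic (R : realType) n (P : 'M[R]_n) (q : 'cV[R]_n) (r : R)
    (x : 'cV[R]_n) : R :=
  qform P x + dotv q x + r.

Definition quadratics (R : realType) n : set ('cV[R]_n -> R) :=
  [set v | exists P q r, symm P /\ v = quadratic P q r].

Section DLQG.
Context {R : realType} (n m : nat).
Variables (A : 'M[R]_n) (B : 'M[R]_(n, m)) (W : 'M[R]_n)
          (m0 : 'cV[R]_n) (Sigma0 : 'M[R]_n)
          (Q0 : 'M[R]_n) (R0 : 'M[R]_m) (alpha : R).

Definition dlqg_obj (P : 'M[R]_n) (q : 'cV[R]_n) (r : R) : R :=
  \tr (P *m Sigma0) + \tr (P *m m0 *m m0^T) + dotv q m0 + r.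

Definition dlqg_mx (P : 'M[R]_n) (q : 'cV[R]_n) (r : R)
    : 'M[R]_(1 + (n + m)) :=
  block3 (r * (alpha - 1) + alpha * \tr (P *m W))
         (2^-1 *: ((- 1%:M + alpha *: A^T) *m q))
         ((alpha / 2) *: (B^T *m q))
         (alpha *: (A^T *m P *m A) - P + Q0)
         (alpha *: (A^T *m P *m B))
         (R0 + alpha *: (B^T *m P *m B)).

Definition dlqg_feasible (P : 'M[R]_n) (q : 'cV[R]_n) (r : R) : Prop :=
  symm P /\ psd (dlqg_mx P q r).

Definition dlqg_value : \bar R :=
  ereal_sup [set e | exists P q r,
                       dlqg_feasible P q r /\ e = (dlqg_obj P q r)%:E].

End DLQG.

Record plqg_var (R : realType) (n m : nat) := PlqgVar {
  Zm  : R;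
  Zmx : 'cV[R]_n;
  Zmu : 'cV[R]_m;
  Zxx : 'M[R]_n;
  Zxu : 'M[R]_(n, m);
  Zuu : 'M[R]_m }.

Section PLQG.
Context {R : realType} (n m : nat).
Variables (A : 'M[R]_n) (B : 'M[R]_(n, m)) (W : 'M[R]_n)
          (m0 : 'cV[R]_n) (Sigma0 : 'M[R]_n)
          (Q0 : 'M[R]_n) (R0 : 'M[R]_m) (alpha : R).
Implicit Types Z : plqg_var R n m.

Definition plqg_obj Z : R := \tr (Q0 *m Zxx Z) + \tr (R0 *m Zuu Z).

Definition plqg_l2 Z : 'M[R]_n :=
  Sigma0 + m0 *m m0^T - Zxx Z
  + alpha *: (A *m Zxx Z *m A^T + A *m Zxu Z *m B^T
              + B *m (Zxu Z)^T *m A^T + B *m Zuu Z *m B^T + Zm Z *: W).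

Definition plqg_l1 Z : 'cV[R]_n :=
  m0 - Zmx Z + alpha *: (A *m Zmx Z + B *m Zmu Z).

Definition plqg_l0 Z : R := alpha * Zm Z - Zm Z + 1.

Definition plqg_cone : set (plqg_var R n m) :=
  [set Z | [/\ symm (Zxx Z), symm (Zuu Z) &
     psd (block3 (Zm Z) (Zmx Z) (Zmu Z) (Zxx Z) (Zxu Z) (Zuu Z))]].

(* The semidefinite program (P-LQG) minimises [plqg_obj] over this set. *)
Definition plqg_feasible : set (plqg_var R n m) :=
  plqg_cone `&` [set Z | [/\ plqg_l2 Z = 0, plqg_l1 Z = 0 & plqg_l0 Z = 0]].

Definition plqg_lagrangian (P : 'M[R]_n) (q : 'cV[R]_n) (r : R) Z : R :=
  plqg_obj Z + \tr (P *m plqg_l2 Z) + dotv q (plqg_l1 Z) + r * plqg_l0 Z.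

(* The equality constraints are dualised; the conic one is kept. *)
Definition plqg_dual (P : 'M[R]_n) (q : 'cV[R]_n) (r : R) : \bar R :=
  ereal_inf [set (plqg_lagrangian P q r Z)%:E | Z in plqg_cone].

Definition plqg_dual_value : \bar R :=
  ereal_sup [set e | exists P q r, symm P /\ e = plqg_dual P q r].

End PLQG.

(* Main.v *)
Require Import Defs.
From HB Require Import structures.
From mathcomp Require Import all_boot all_order all_algebra.
From mathcomp Require Import all_classical all_reals all_analysis.
From mathcomp Require Import measurable_realfun ring lra.
(** Integrating [x^T P x + q^T x + r] against a law only involves its first two
    moments, so the slack [c0 - T* v] at [(x, u)] is the quadratic form of the
    (D-LQG) matrix at [(1, x, u)]; by homogeneity and density of the vectors
    whose first coordinate is nonzero, it is nonnegative everywhere iff that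
    matrix is positive semidefinite.  The moments of a Gaussian law come from
    differentiating its moment generating function, itself obtained by
    completing the square in the density.

    On the dual side, the Lagrangian of (P-LQG) at [Z] is the (D-LQG) objective
    plus the trace of the product of the (D-LQG) matrix with [Z].  That trace is
    nonnegative when both matrices are positive semidefinite, and it is unbounded
    below along a ray [k *: (z *m z^T)] otherwise. *)

Set Implicit Arguments.
Unset Strict Implicit.
Unset Printing Implicit Defensive.
Import Order.TTheory GRing.Theory Num.Theory.
Import numFieldNormedType.Exports.
Local Open Scope classical_set_scope.
Local Open Scope ring_scope.

(** * Quadratic forms, bordered block matrices and positive semidefiniteness *)

Section LinearAlgebra.
Context {R : realType}.

Lemma dotvE n (a x : 'cV[R]_n) : dotv a x = \sum_i a i 0 * x i 0.
Proof. by rewrite /dotv mxE; apply: eq_bigr => i _; rewrite mxE. Qed.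

Lemma dotvC n (a x : 'cV[R]_n) : dotv a x = dotv x a.
Proof. by rewrite !dotvE; apply: eq_bigr => i _; rewrite mulrC. Qed.

Lemma dotv_ge0 n (x : 'cV[R]_n) : 0 <= dotv x x.
Proof. by rewrite dotvE; apply: sumr_ge0 => i _; rewrite -expr2 sqr_ge0. Qed.

Lemma dotv_trace n (a x : 'cV[R]_n) : dotv a x = \tr (x *m a^T).
Proof. by rewrite mxtrace_mulC /mxtrace big_ord1. Qed.

Lemma dotvDr n (a x y : 'cV[R]_n) : dotv a (x + y) = dotv a x + dotv a y.
Proof. by rewrite /dotv mulmxDr mxE. Qed.

Lemma dotvZr n (k : R) (a x : 'cV[R]_n) : dotv a (k *: x) = k * dotv a x.
Proof. by rewrite /dotv -scalemxAr mxE. Qed.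

Lemma dotvDl n (a b x : 'cV[R]_n) : dotv (a + b) x = dotv a x + dotv b x.
Proof. by rewrite /dotv linearD /= mulmxDl mxE. Qed.

Lemma dotvZl n (k : R) (a x : 'cV[R]_n) : dotv (k *: a) x = k * dotv a x.
Proof. by rewrite /dotv linearZ /= -scalemxAl mxE. Qed.

Lemma dotv_mull m n (M : 'M[R]_(m, n)) (a : 'cV[R]_m) (x : 'cV[R]_n) :
  dotv (M^T *m a) x = dotv a (M *m x).
Proof. by rewrite /dotv trmx_mul trmxK mulmxA. Qed.

Lemma qform_trace n (M : 'M[R]_n) (x : 'cV[R]_n) :
  qform M x = \tr (M *m (x *m x^T)).
Proof.
by rewrite /qform mulmxA mxtrace_mulC mulmxA /mxtrace big_ord1.
Qed.

Lemma qformE n (M : 'M[R]_n) (x : 'cV[R]_n) :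
  qform M x = \sum_i \sum_j M i j * (x i 0 * x j 0).
Proof.
rewrite /qform -mulmxA mxE; apply: eq_bigr => i _; rewrite !mxE mulr_sumr.
by apply: eq_bigr => j _; rewrite mulrCA.
Qed.

Lemma qformZ n (M : 'M[R]_n) (k : R) (x : 'cV[R]_n) :
  qform M (k *: x) = k ^+ 2 * qform M x.
Proof.
by rewrite /qform -scalemxAr linearZ /= -!scalemxAl scalerA mxE.
Qed.

Lemma qformD n (M N : 'M[R]_n) (x : 'cV[R]_n) :
  qform (M + N) x = qform M x + qform N x.
Proof. by rewrite !qform_trace mulmxDl mxtraceD. Qed.

Lemma qform_outer n (w x : 'cV[R]_n) : qform (w *m w^T) x = (dotv w x) ^+ 2.
Proof.
rewrite /qform mulmxA -mulmxA mxE big_ord1 expr2; congr (_ * _).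
by rewrite -[w]trmxK -trmx_mul mxE trmxK.
Qed.

(** Polarization: the form at [e_i + e_j], minus its values at [e_i] and [e_j], is twice the entry
    [(i, j)]. *)
Lemma symm_qform_inj n (M N : 'M[R]_n) :
  symm M -> symm N -> qform M =1 qform N -> M = N.
Proof.
move=> sM sN eMN.
have polar (K : 'M[R]_n) i j : symm K ->
    K i j *+ 2 = qform K (delta_mx i 0 + delta_mx j 0)
      - qform K (delta_mx i 0) - qform K (delta_mx j 0).
  move=> sK.
  have dE k l :
      ((delta_mx k 0 : 'cV[R]_n)^T *m K *m (delta_mx l 0 : 'cV[R]_n)) 0 0 = K k l.
    by rewrite trmx_delta -rowE -colE !mxE.
  have trD (x y : 'cV[R]_n) : (x + y)^T = x^T + y^T by rewrite linearD.
  rewrite /qform trD !mulmxDl !mulmxDr.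
  have dD (X Y : 'M[R]_1) : (X + Y) 0 0 = X 0 0 + Y 0 0 by rewrite mxE.
  have sKij : K j i = K i j by rewrite -{1}sK mxE.
  by rewrite !dD !dE sKij; ring.
apply/matrixP => i j; apply: (@mulIf _ 2%:R); first by rewrite pnatr_eq0.
by rewrite !mulr_natr !polar// !eMN.
Qed.

(** This is [block3] with its last two blocks merged, which isolates the first coordinate for the
    factorization and homogenization arguments. *)
Definition block2 n (s0 : R) (s1 : 'cV[R]_n) (S : 'M[R]_n) : 'M[R]_(1 + n) :=
  block_mx s0%:M s1^T s1 S.

Lemma trace_block2 n (s0 z0 : R) (s1 z1 : 'cV[R]_n) (S Z : 'M[R]_n) :
  \tr (block2 s0 s1 S *m block2 z0 z1 Z) = s0 * z0 + 2 * dotv s1 z1 + \tr (S *m Z).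
Proof.
rewrite /block2 mulmx_block mxtrace_block !mxtraceD -scalar_mxM mxtrace_scalar.
by rewrite mulr1n [\tr (s1^T *m z1)]mxtrace_mulC -!dotv_trace (dotvC z1); ring.
Qed.

Lemma block2_outer n (t : R) (x : 'cV[R]_n) :
  col_mx t%:M x *m (col_mx t%:M x)^T = block2 (t ^+ 2) (t *: x) (x *m x^T).
Proof.
rewrite !tr_col_mx mul_col_row /block2 tr_scalar_mx -scalar_mxM.
by rewrite mul_scalar_mx mul_mx_scalar linearZ.
Qed.

Lemma block3E n m (s0 : R) (s1 : 'cV[R]_n) (s2 : 'cV[R]_m)
    (S11 : 'M[R]_n) (S12 : 'M[R]_(n, m)) (S22 : 'M[R]_m) :
  block3 s0 s1 s2 S11 S12 S22 =
  block2 s0 (col_mx s1 s2) (block_mx S11 S12 S12^T S22).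
Proof. by rewrite /block2 tr_col_mx. Qed.

Lemma trace_block3 n m (s0 z0 : R) (s1 z1 : 'cV[R]_n) (s2 z2 : 'cV[R]_m)
    (S11 Z11 : 'M[R]_n) (S12 Z12 : 'M[R]_(n, m)) (S22 Z22 : 'M[R]_m) :
  \tr (block3 s0 s1 s2 S11 S12 S22 *m block3 z0 z1 z2 Z11 Z12 Z22) =
  s0 * z0 + 2 * (dotv s1 z1 + dotv s2 z2)
  + \tr (S11 *m Z11) + 2 * \tr (S12 *m Z12^T) + \tr (S22 *m Z22).
Proof.
have dE : dotv (col_mx s1 s2) (col_mx z1 z2) = dotv s1 z1 + dotv s2 z2.
  by rewrite /dotv tr_col_mx mul_row_col mxE.
rewrite !block3E trace_block2 dE mulmx_block mxtrace_block !mxtraceD.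
by rewrite -(mxtrace_tr (S12^T *m _)) trmx_mul trmxK (mxtrace_mulC _ S12); ring.
Qed.

(** Shows which blocks make up the rank-one matrix [z *m z^T], so that a quadratic form at [z]
    becomes a trace against a point of the (P-LQG) cone. *)
Lemma block3_outer n m (t : R) (x : 'cV[R]_n) (u : 'cV[R]_m) :
  col_mx t%:M (col_mx x u) *m (col_mx t%:M (col_mx x u))^T =
  block3 (t ^+ 2) (t *: x) (t *: u) (x *m x^T) (x *m u^T) (u *m u^T).
Proof.
rewrite block2_outer block3E scale_col_mx; congr block2.
by rewrite tr_col_mx mul_col_row trmx_mul trmxK.
Qed.

Lemma symm_block3 n m (s0 : R) (s1 : 'cV[R]_n) (s2 : 'cV[R]_m)
    (S11 : 'M[R]_n) (S12 : 'M[R]_(n, m)) (S22 : 'M[R]_m) :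
  symm S11 -> symm S22 -> symm (block3 s0 s1 s2 S11 S12 S22).
Proof.
move=> h1 h2; rewrite /symm /block3 !tr_block_mx tr_scalar_mx tr_row_mx tr_col_mx.
by rewrite !trmxK h1 h2.
Qed.

Lemma col_mx_scalarP n (z : 'cV[R]_(1 + n)) : exists t y, z = col_mx t%:M y.
Proof.
exists (usubmx z 0 0), (dsubmx z).
by rewrite -[LHS]vsubmxK [usubmx z in LHS]mx11_scalar.
Qed.

Lemma symm_block2P n (Z : 'M[R]_(1 + n)) :
  symm Z -> exists a b D, Z = block2 a b D /\ symm D.
Proof.
move=> sZ; exists (ulsubmx Z 0 0), (dlsubmx Z), (drsubmx Z).
split; last by rewrite /symm trmx_drsub sZ.
by rewrite /block2 -[LHS]submxK [ulsubmx Z in LHS]mx11_scalar trmx_dlsub sZ.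
Qed.

Lemma qform_block2 n (a : R) (b : 'cV[R]_n) (D : 'M[R]_n) (t : R) (y : 'cV[R]_n) :
  qform (block2 a b D) (col_mx t%:M y) =
  a * t ^+ 2 + 2 * (t * dotv b y) + qform D y.
Proof. by rewrite qform_trace block2_outer trace_block2 dotvZr -qform_trace. Qed.

Lemma affine_ge0_slope0 (b c : R) : (forall t, 0 <= t * b + c) -> b = 0.
Proof.
move=> h; apply/eqP; apply: contraT => b0.
(* This [t] solves [t * b + c = -1]. *)
by have := h ((- 1 - c) / b); rewrite divfK// subrK oppr_ge0 ler10.
Qed.

(** Induction on the size: the Schur complement of the top left entry is again positive
    semidefinite. A zero pivot is allowed, since its border then vanishes. *)
Lemma psd_cholesky n (Z : 'M[R]_n) : psd Z -> exists V : 'M[R]_n, Z = V *m V^T.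
Proof.
elim: n Z => [|n IHn] Z; first by exists 0; apply/matrixP => -[].
rewrite -[n.+1]/(1 + n)%N in Z *.
move=> [/symm_block2P[a [b [D [-> sD]]]] pZ].
have qZ t y : 0 <= a * t ^+ 2 + 2 * (t * dotv b y) + qform D y.
  by rewrite -qform_block2.
have a0 : 0 <= a.
  by have := qZ 1 0; rewrite /qform /dotv !mulmx0 !mxE; lra.
(* With a zero pivot the form is affine in the first coordinate, so nonnegativity kills its
   slope. *)
have b0 : a = 0 -> b = 0.
  move=> aE; apply/matrixP => i j; rewrite ord1 [RHS]mxE.
  have dE : dotv b (delta_mx i 0) = b i 0.
    by rewrite /dotv -colE !mxE.
  apply: (@affine_ge0_slope0 _ (qform D (delta_mx i 0))) => t.
  by have := qZ (t / 2) (delta_mx i 0); rewrite aE dE; lra.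
pose s := Num.sqrt a; have s2 : s ^+ 2 = a by rewrite sqr_sqrtr.
(* [w] is the rest of the first column of the factor: [b / s], or 0 when the pivot is 0. *)
have [w sw w0] : exists2 w, s *: w = b & s = 0 -> w = 0.
  have [sE|s0] := eqVneq s 0; last first.
    by exists (s^-1 *: b) => [|/eqP/[!negbTE s0]//]; rewrite scalerA divff// scale1r.
  by exists 0 => //; rewrite scaler0 b0// -s2 sE expr0n.
have [V' V'E] : exists V : 'M[R]_n, D - w *m w^T = V *m V^T.
  apply: IHn; split.
    by rewrite /symm linearB /= trmx_mul trmxK sD.
  move=> y; rewrite qformD -mulNmx.
  have -> : qform (- w *m w^T) y = - (dotv w y) ^+ 2.
    by rewrite -qform_outer mulNmx /qform mulmxN mulNmx mxE.
  have [sE|sN0] := eqVneq s 0.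
    rewrite w0// /dotv trmx0 mul0mx mxE expr0n oppr0 addr0.
    by have := qZ 0 y; rewrite expr0n mul0r !mulr0 !add0r.
  (* This first coordinate minimizes the form for fixed [y]; the minimum is the Schur complement at
     [y]. *)
  have := qZ (- (dotv w y / s)) y; rewrite -sw dotvZl -s2.
  have -> : s ^+ 2 * (- (dotv w y / s)) ^+ 2 = dotv w y ^+ 2 by field.
  have -> : - (dotv w y / s) * (s * dotv w y) = - dotv w y ^+ 2 by field.
  by lra.
exists (block_mx s%:M 0 w V').
rewrite tr_block_mx mulmx_block !trmx0 !mulmx0 !mul0mx !addr0 tr_scalar_mx.
rewrite -V'E addrC subrK -scalar_mxM -expr2 s2 mul_mx_scalar mul_scalar_mx.
by rewrite sw -linearZ /= sw.
Qed.

(** Writing [Z = V *m V^T], the trace is the sum of the values of the form of [M] at the columns of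
    [V]. *)
Lemma trace_psd_ge0 n (M Z : 'M[R]_n) : psd M -> psd Z -> 0 <= \tr (M *m Z).
Proof.
move=> [_ pM] /psd_cholesky[V ->].
rewrite mulmxA mxtrace_mulC mulmxA; apply: sumr_ge0 => i _.
suff -> : (V^T *m M *m V) i i = qform M (col i V) by [].
rewrite /qform tr_col -row_mul mxE [RHS]mxE.
by apply: eq_bigr => j _; rewrite !mxE.
Qed.

Lemma psd_outer n (x : 'cV[R]_n) : psd (x *m x^T).
Proof.
split=> [|y]; first by rewrite /symm trmx_mul trmxK.
by rewrite qform_outer sqr_ge0.
Qed.

Lemma psdZ n (k : R) (M : 'M[R]_n) : 0 <= k -> psd M -> psd (k *: M).
Proof.
move=> k0 [sM pM]; split=> [|x]; first by rewrite /symm linearZ /= sM.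
by rewrite /qform -scalemxAr -scalemxAl mxE mulr_ge0// pM.
Qed.

(** Right continuity at 0, made explicit: [t] is chosen so that the nonconstant terms contribute at
    most [e]. *)
Lemma quadratic_ge0_at0 (s b c : R) :
  (forall t, 0 < t -> 0 <= s * t ^+ 2 + b * t + c) -> 0 <= c.
Proof.
move=> h; apply/ler_addgt0Pr => e e0.
pose K := `|s| + `|b| + 1.
have K0 : 0 < K by rewrite ltr_wpDl// addr_ge0.
pose t := Num.min 1 (e / K).
have t0 : 0 < t by rewrite lt_min ltr01 divr_gt0.
have t1 : t <= 1 by rewrite ge_min lexx.
have tK : t * K <= e by rewrite -ler_pdivlMr// ge_min lexx orbT.
apply: (le_trans (h t t0)); rewrite [leRHS]addrC lerD2r; apply: le_trans tK.
rewrite /K mulrDr mulrDr; apply: (@le_trans _ _ (t * `|s| + t * `|b|)).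
  apply: lerD; last by rewrite mulrC ler_wpM2l ?ler_norm// ltW.
  apply: (@le_trans _ _ (`|s| * t ^+ 2)).
    by rewrite ler_wpM2r ?ler_norm// sqr_ge0.
  by rewrite mulrC ler_wpM2r// expr2 ler_piMl// ltW.
by rewrite lerDl mulr1 ltW.
Qed.

(* Where the first coordinate is nonzero, a dense set, it may be scaled to 1. *)
Lemma psd_homogenize n (M : 'M[R]_(1 + n)) :
  symm M -> (forall y, 0 <= qform M (col_mx 1%:M y)) -> psd M.
Proof.
move=> sM h; split=> // z; have [t [y ->]] := col_mx_scalarP z.
have hN t' : t' != 0 -> 0 <= qform M (col_mx t'%:M y).
  move=> t0; have -> : col_mx t'%:M y = t' *: col_mx 1%:M (t'^-1 *: y).
    by rewrite scale_col_mx scale_scalar_mx mulr1 scalerA divff// scale1r.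
  by rewrite qformZ mulr_ge0// sqr_ge0.
have [->|/hN//] := eqVneq t 0.
have [a [b [D [ME _]]]] := symm_block2P sM.
rewrite ME qform_block2 expr0n mul0r !mulr0 !add0r.
apply: (@quadratic_ge0_at0 a (2 * dotv b y)) => e e0.
have := hN e (lt0r_neq0 e0); rewrite ME qform_block2.
by congr (_ <= _); ring.
Qed.

End LinearAlgebra.

(** * The Lagrangian of (P-LQG) and its infimum over the cone *)

Section LQGAlgebra.
Context {R : realType} (n m : nat).
Variables (A : 'M[R]_n) (B : 'M[R]_(n, m)) (W : 'M[R]_n)
          (m0 : 'cV[R]_n) (Sigma0 : 'M[R]_n)
          (Q0 : 'M[R]_n) (R0 : 'M[R]_m) (alpha : R).
Implicit Types (P : 'M[R]_n) (q : 'cV[R]_n) (r : R) (Z : plqg_var R n m).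

Definition plqg_mx Z : 'M[R]_(1 + (n + m)) :=
  block3 (Zm Z) (Zmx Z) (Zmu Z) (Zxx Z) (Zxu Z) (Zuu Z).

(** Cyclicity of the trace moves [A] and [B] from [Z] onto the multipliers, so the (D-LQG) matrix is
    the cost plus the adjoint of the constraint map. *)
Lemma plqg_lagrangianE P q r Z : symm P ->
  plqg_lagrangian A B W m0 Sigma0 Q0 R0 alpha P q r Z =
  dlqg_obj m0 Sigma0 P q r + \tr (dlqg_mx A B W Q0 R0 alpha P q r *m plqg_mx Z).
Proof.
move=> sP; rewrite /plqg_mx trace_block3 /plqg_lagrangian /dlqg_obj /plqg_obj.
rewrite /plqg_l2 /plqg_l1 /plqg_l0; case: Z => z0 z1 z2 Z11 Z12 Z22 /=.
have t11 : \tr (P *m (A *m Z11 *m A^T)) = \tr (A^T *m P *m A *m Z11).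
  by rewrite !mulmxA mxtrace_mulC !mulmxA.
(* Transposing and using the symmetry of [P] makes both cross terms equal, which accounts for the
   factor 2 in [trace_block3]. *)
have t12 : \tr (P *m (A *m Z12 *m B^T)) = \tr (A^T *m P *m B *m Z12^T).
  rewrite -mxtrace_tr !trmx_mul !trmxK sP -!mulmxA mxtrace_mulC.
  by rewrite -!mulmxA mxtrace_mulC !mulmxA.
have t21 : \tr (P *m (B *m Z12^T *m A^T)) = \tr (A^T *m P *m B *m Z12^T).
  by rewrite !mulmxA mxtrace_mulC !mulmxA.
have t22 : \tr (P *m (B *m Z22 *m B^T)) = \tr (B^T *m P *m B *m Z22).
  by rewrite !mulmxA mxtrace_mulC !mulmxA.
have trN k (X : 'M[R]_k) : \tr (- X) = - \tr X by rewrite linearN.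
rewrite !(mulmxDr, mulmxN, mxtraceD, trN, =^~ scalemxAr, mxtraceZ).
rewrite !(mulmxDl, mulNmx, mxtraceD, trN, =^~ scalemxAl, mxtraceZ).
rewrite t11 t12 t21 t22 !(dotvDr, dotvZr, dotvZl) mulmxA.
rewrite mul1mx -(scale1r (- q)) scalerN -scaleNr dotvDl !dotvZl !dotv_mull.
by rewrite -[- z1]scaleN1r dotvZr; field.
Qed.

Lemma symm_dlqg_mx P q r : symm P -> symm Q0 -> symm R0 ->
  symm (dlqg_mx A B W Q0 R0 alpha P q r).
Proof.
move=> sP sQ sR; rewrite /dlqg_mx; apply: symm_block3.
  have s1 : (A^T *m P *m A)^T = A^T *m P *m A.
    by rewrite !trmx_mul trmxK sP mulmxA.
  by rewrite /symm linearD linearB /= linearZ /= s1 sP sQ.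
have s2 : (B^T *m P *m B)^T = B^T *m P *m B.
  by rewrite !trmx_mul trmxK sP mulmxA.
by rewrite /symm linearD /= linearZ /= s2 sR.
Qed.

(** The trace term is nonnegative on the cone and vanishes at [Z = 0], where the infimum is
    attained. *)
Lemma plqg_dual_feasible P q r : dlqg_feasible A B W Q0 R0 alpha P q r ->
  plqg_dual A B W m0 Sigma0 Q0 R0 alpha P q r = (dlqg_obj m0 Sigma0 P q r)%:E.
Proof.
move=> [sP pM]; apply/eqP; rewrite eq_le; apply/andP; split.
  apply: ge_ereal_inf; eexists; last exact: lexx.
  have b0 : block3 0 0 0 0 0 0 = 0 :> 'M[R]_(1 + (n + m)).
    rewrite /block3 !trmx0 row_mx0 col_mx0 block_mx0.
    by rewrite (_ : 0%:M = 0) ?block_mx0//; exact: raddf0.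
  exists (PlqgVar 0 0 0 0 0 0); last first.
    by rewrite plqg_lagrangianE// /plqg_mx /= b0 mulmx0 mxtrace0 addr0.
  split; rewrite /= ?b0 /symm ?trmx0//; split=> [|x]; first by rewrite /symm trmx0.
  by rewrite /qform mulmx0 mul0mx mxE.
apply/ereal_infP => _ [Z [_ _ pZ] <-]; rewrite lee_fin plqg_lagrangianE// lerDl.
exact: trace_psd_ge0.
Qed.

(** Some [z] makes the form of the (D-LQG) matrix negative; along the ray [k *: (z *m z^T)] of the
    cone the Lagrangian is affine in [k] with that negative slope. *)
Lemma plqg_dual_infeasible P q r : symm P -> symm Q0 -> symm R0 ->
  ~ dlqg_feasible A B W Q0 R0 alpha P q r ->
  plqg_dual A B W m0 Sigma0 Q0 R0 alpha P q r = -oo%E.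
Proof.
move=> sP sQ sR nF; set M := dlqg_mx A B W Q0 R0 alpha P q r.
have [z qz] : exists z, qform M z < 0.
  apply: contra_notP nF => /forallNP nz; split=> //; split.
    exact: symm_dlqg_mx.
  by move=> z; rewrite leNgt; apply/negP.
have [t [y zE0]] := col_mx_scalarP z.
have [x [u zE]] : exists x u, z = col_mx t%:M (col_mx x u).
  by exists (usubmx y), (dsubmx y); rewrite vsubmxK zE0.
pose Zk k := PlqgVar (k * t ^+ 2) (k *: (t *: x)) (k *: (t *: u))
  (k *: (x *m x^T)) (k *: (x *m u^T)) (k *: (u *m u^T)).
have ZkE k : plqg_mx (Zk k) = k *: (z *m z^T).
  have trZ a b c (X : 'M[R]_(b, c)) : (a *: X)^T = a *: X^T by rewrite linearZ.
  rewrite zE block3_outer /plqg_mx /block3 /= scale_block_mx scale_scalar_mx.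
  by rewrite scale_row_mx scale_col_mx scale_block_mx !trZ.
have LE k : plqg_lagrangian A B W m0 Sigma0 Q0 R0 alpha P q r (Zk k) =
    dlqg_obj m0 Sigma0 P q r + k * qform M z.
  by rewrite plqg_lagrangianE// ZkE -scalemxAr mxtraceZ -qform_trace.
have cZk k : 0 <= k -> plqg_cone (Zk k).
  move=> k0; split; last by rewrite -/(plqg_mx (Zk k)) ZkE; exact/psdZ/psd_outer.
  - by have [] := psdZ k0 (psd_outer x).
  - by have [] := psdZ k0 (psd_outer u).
(* Seeing [-oo] as the infimum of all reals, it suffices to go below an arbitrary real [K]. *)
apply/eqP; rewrite eq_le leNye andbT -ereal_inf_real.
apply/ereal_infP => _ [K _ <-].
apply: ge_ereal_inf; eexists.
  (* With this [k] the Lagrangian equals the objective minus its absolute value minus [|K|], hence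
     is at most [K]. *)
  exists (Zk ((`|K| + `|dlqg_obj m0 Sigma0 P q r|) / - qform M z)); last by [].
  by apply: cZk; rewrite divr_ge0 ?addr_ge0// oppr_ge0 ltW.
rewrite lee_fin LE invrN mulrN mulNr divfK ?lt_eqF//.
have := ler_norm (dlqg_obj m0 Sigma0 P q r); have := ler_norm (- K).
by rewrite normrN; lra.
Qed.

End LQGAlgebra.

(** Instance of the Lagrangian identity at the rank-one [Z] built from [(1, x, u)], with zero
    initial mean and covariance so that the objective reduces to [r]. *)
Lemma qform_dlqg (R : realType) (n m : nat)
    (A : 'M[R]_n) (B : 'M[R]_(n, m)) (W : 'M[R]_n)
    (Q0 : 'M[R]_n) (R0 : 'M[R]_m) (alpha : R)
    (P : 'M[R]_n) (q : 'cV[R]_n) (r : R) (x : 'cV[R]_n) (u : 'cV[R]_m) :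
  symm P ->
  qform (dlqg_mx A B W Q0 R0 alpha P q r) (col_mx 1%:M (col_mx x u)) =
  qform Q0 x + qform R0 u - (quadratic P q r x -
    alpha * (\tr (P *m W) + quadratic P q r (A *m x + B *m u))).
Proof.
move=> sP; rewrite qform_trace block3_outer expr1n !scale1r.
have := @plqg_lagrangianE R n m A B W 0 0 Q0 R0 alpha P q r
  (PlqgVar 1 x u (x *m x^T) (x *m u^T) (u *m u^T)) sP.
rewrite /plqg_lagrangian /plqg_obj /plqg_l2 /plqg_l1 /plqg_l0 /plqg_mx /dlqg_obj /=.
have trD (y z : 'cV[R]_n) : (y + z)^T = y^T + z^T by rewrite linearD.
(* The dynamics part of (C2) collapses to the outer product of the mean successor state with
   itself. *)
have -> : A *m (x *m x^T) *m A^T + A *m (x *m u^T) *m B^T +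
      B *m (x *m u^T)^T *m A^T + B *m (u *m u^T) *m B^T =
    (A *m x + B *m u) *m (A *m x + B *m u)^T.
  rewrite trD mulmxDl !mulmxDr !trmx_mul trmxK !mulmxA !addrA.
  by rewrite -!addrA; congr (_ + _); rewrite addrCA.
rewrite /quadratic !qform_trace; set mu := A *m x + B *m u.
have dN : dotv q (- x) = - dotv q x by rewrite -scaleN1r dotvZr mulN1r.
have d0 : dotv q 0 = 0 by rewrite /dotv mulmx0 mxE.
rewrite !mulmx0 !mul0mx !add0r mulmxDr mulmxN -scalemxAr mulmxDr !scale1r.
have trN (X : 'M[R]_n) : \tr (- X) = - \tr X by rewrite linearN.
rewrite !mxtraceD mxtraceZ mxtraceD trN mxtrace0 dotvDr dN dotvZr d0.
by lra.
Qed.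

(** * Moments of a real random variable from its moment generating function *)

Lemma is_derive_expR_comp (R : realType) (g : R -> R) (t dg : R) :
  is_derive t 1 g dg -> is_derive t 1 (fun t => expR (g t)) (expR (g t) * dg).
Proof. by move=> h; exact: (@is_derive1_comp _ expR g). Qed.

Section MomentsFromMGF.
Context d (T : measurableType d) (R : realType) (P : probability T R).
Variables (Y : T -> R) (mu s : R).
Hypothesis mY : measurable_fun [set: T] Y.
Hypothesis mgf : forall t,
  (\int[P]_x (expR (t * Y x))%:E)%E = (expR (t * mu + t ^+ 2 * s / 2))%:E.

(** The [k]-th derivative in [t] of [expR (t * Y x)]. *)
Let f k t x := Y x ^+ k * expR (t * Y x).

Let measurable_f k t : measurable_fun [set: T] (f k t).
Proof.
apply: measurable_funM; first exact: measurable_funX.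
by apply: measurableT_comp => //; exact: measurable_funM.
Qed.

Let integrable_expRM t : P.-integrable [set: T] (fun x => (expR (t * Y x))%:E).
Proof.
apply/integrableP; split.
  apply/measurable_EFinP; apply: measurableT_comp => //; exact: measurable_funM.
under eq_integral do rewrite gee0_abs ?lee_fin ?expR_ge0//.
by rewrite mgf ltry.
Qed.

(** Integrable majorant of [f k t] for all [|t| <= c]: one exponential for each sign of [Y x], both
    integrable by the generating function hypothesis. *)
Let G (c : R) k x := expR ((k%:R + c) * Y x) + expR (- (k%:R + c) * Y x).

Let integrable_G c k : P.-integrable [set: T] (EFin \o G c k).
Proof.
rewrite (_ : EFin \o G c k = fun x =>
  ((expR ((k%:R + c) * Y x))%:E + (expR (- (k%:R + c) * Y x))%:E)%E) //.
exact: integrableD.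
Qed.

Let f_ub c k t x : `|t| <= c -> `|f k t x| <= G c k x.
Proof.
move=> tc; rewrite normrM normrX (ger0_norm (expR_ge0 _)).
(* [|Y| <= 1 + |Y| <= expR |Y|] absorbs the power [k] into the exponential. *)
apply: (@le_trans _ _ (expR ((k%:R + c) * `|Y x|))).
  rewrite mulrDl expRD; apply: ler_pM; rewrite ?exprn_ge0 ?expR_ge0//.
    rewrite -mulr_natl [k%:R * _]mulr_natl expRM_natl.
    rewrite lerXn2r ?nnegrE ?expR_ge0//.
    by apply: le_trans (expR_ge1Dx _); rewrite lerDr.
  rewrite ler_expR; apply: (le_trans (ler_norm _)).
  by rewrite normrM ler_wpM2r.
rewrite /G; have [Y0|Y0] := leP 0 (Y x).
  by rewrite ger0_norm// lerDl expR_ge0.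
by rewrite ltr0_norm// mulrN -mulNr lerDr expR_ge0.
Qed.

Lemma integrable_XnexpR k t : P.-integrable [set: T] (EFin \o f k t).
Proof.
apply: le_integrable (integrable_G `|t| k) => //.
  exact/measurable_EFinP.
move=> x _ /=; rewrite lee_fin.
by apply: le_trans (ler_norm _); exact: f_ub.
Qed.

Let M k t := (\int[P]_x f k t x)%R.

Let is_derive_f k (x : T) (t : R) : is_derive t 1 (f k ^~ x) (f k.+1 t x).
Proof.
have h : is_derive t 1 (fun t : R => t * Y x) (Y x).
  by apply: is_derive_eq; rewrite scaler0 add0r /GRing.scale /= mulr1.
have {}h := is_derive_expR_comp h.
rewrite [X in is_derive _ _ X _](_ : _ =
  Y x ^+ k *: (fun t : R => expR (t * Y x))) //.
by apply: is_derive_eq; rewrite /f exprS /GRing.scale /=; ring.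
Qed.

(** Differentiation under the integral sign: on the unit neighbourhood of [t], parameters are
    bounded by [|t| + 1], so one [G] dominates all the derivatives. *)
Let is_derive_M k (t : R) : is_derive t 1 (M k) (M k.+1 t).
Proof.
have tI : `]t - 1, t + 1[%classic t by rewrite /= in_itv /=; apply/andP; split; lra.
have dE a x : partial1of2 (f k) a x = f k.+1 a x.
  by rewrite partial1of2E; apply: derive_val.
have fub (a : R) (x : T) : `]t - 1, t + 1[%classic a -> [set: T] x ->
    `|partial1of2 (f k) a x| <= G (`|t| + 1) k.+1 x.
  rewrite /= in_itv /= => /andP[a1 a2] _; rewrite dE; apply: f_ub.
  rewrite -[a](subrK t) addrC (le_trans (ler_normD _ _))// lerD2l.
  by rewrite ler_norml; apply/andP; split; lra.
have df (a : R) (x : T) : `]t - 1, t + 1[%classic a -> [set: T] x ->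
  derivable (f k ^~ x) a 1 by [].
have G0 x : 0 <= G (`|t| + 1) k.+1 x by rewrite addr_ge0 ?expR_ge0.
have iG := integrable_G (`|t| + 1) k.+1.
have intf (a : R) : `]t - 1, t + 1[%classic a -> P.-integrable setT (EFin \o f k a).
  by move=> _; exact: integrable_XnexpR.
apply: DeriveDef.
  exact: (derivable_under_integral measurableT tI intf df G0 iG fub).
rewrite -derive1E (differentiation_under_integral measurableT tI intf df G0 iG fub).
by apply: eq_Rintegral => x _; rewrite dE.
Qed.

Let e (t : R) := expR (t * mu + t ^+ 2 * s / 2).

Let is_derive_e (t : R) : is_derive t 1 e ((mu + t * s) * e t).
Proof.
have h : is_derive t 1 (fun t : R => t * mu + t ^+ 2 * s / 2) (mu + t * s).
  by apply: is_derive_eq; rewrite /GRing.scale /= -mulr_natl; field.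
rewrite mulrC; exact: is_derive_expR_comp h.
Qed.

Let M0E : M 0 = e.
Proof.
apply/funext => t; rewrite /M /f /Rintegral.
by under eq_integral do rewrite expr0 mul1r; rewrite mgf.
Qed.

Let M1E : M 1 = fun t => (mu + t * s) * e t.
Proof.
apply/funext => t; rewrite -(@derive_val _ _ _ _ _ _ _ (is_derive_e t)) -M0E.
exact/esym/derive_val/is_derive_M.
Qed.

Lemma mgf_moment1 : (\int[P]_x Y x)%R = mu.
Proof.
have <- : M 1 0 = mu.
  by rewrite M1E /e !mul0r expr0n !mul0r !addr0 expR0 mulr1.
by apply: eq_Rintegral => x _; rewrite /f expr1 mul0r expR0 mulr1.
Qed.

(** The second moment is the derivative at 0 of [M 1], whose closed form [(mu + t * s) * e t] is
    known. *)
Lemma mgf_moment2 : (\int[P]_x (Y x ^+ 2))%R = s + mu ^+ 2.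
Proof.
have <- : M 2 0 = s + mu ^+ 2.
  have <- := @derive_val _ _ _ _ _ _ _ (is_derive_M 1 0).
  rewrite M1E.
  have e0 : e 0 = 1 by rewrite /e !mul0r expr0n !mul0r !addr0 expR0.
  have h : is_derive (0 : R) 1 (fun t : R => mu + t * s) s.
    by apply: is_derive_eq; rewrite /GRing.scale /=; ring.
  have := is_deriveM h (is_derive_e 0) => /(@derive_val _ _ _ _ _ _ _) hM.
  rewrite [LHS]hM e0 /GRing.scale /=; ring.
by apply: eq_Rintegral => x _; rewrite /f mul0r expR0 mulr1.
Qed.

Lemma mgf_integrable k : P.-integrable [set: T] (EFin \o (fun x => Y x ^+ k)).
Proof.
apply: eq_integrable (integrable_XnexpR k 0) => // x _ /=.
by rewrite /f mul0r expR0 mulr1.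
Qed.

End MomentsFromMGF.

(** * Moment generating function of the univariate normal law *)

Section NormalMGF.
Context {R : realType}.
Implicit Types m s t : R.

Local Notation mu := (@lebesgue_measure R).

(** The Radon-Nikodym derivative with respect to Lebesgue measure and the density have the same
    integral over every measurable set, hence agree almost everywhere. *)
Lemma ge0_integral_normal_prob m s (f : R -> \bar R) : (forall x, (0 <= f x)%E) ->
  measurable_fun [set: measurableTypeR R] f ->
  (\int[normal_prob m s]_x f x = \int[mu]_x (f x * (normal_pdf m s x)%:E))%E.
Proof.
move=> f0 mf; have dom := @normal_prob_dominates R m s.
have mpdf : measurable_fun [set: measurableTypeR R] (EFin \o normal_pdf m s).
  by apply/measurable_EFinP; exact: measurable_normal_pdf.
have ifn := Radon_Nikodym_SigmaFinite.f_integrable dom.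
rewrite -(Radon_Nikodym_SigmaFinite.change_of_variables dom)//.
apply: ae_eq_integral => //.
- by apply: emeasurable_funM => //; exact: measurable_int ifn.
- by apply: emeasurable_funM.
apply: ae_eqe_mul2l; apply: integral_ae_eq => // E _ mE.
by rewrite -Radon_Nikodym_SigmaFinite.f_integral.
Qed.

Lemma integral_expR_normal_prob m s t : s != 0 ->
  (\int[normal_prob m s]_x (expR (t * x))%:E =
   (expR (t * m + t ^+ 2 * s ^+ 2 / 2))%:E)%E.
Proof.
move=> s0; rewrite ge0_integral_normal_prob; last 2 first.
- by move=> x; rewrite lee_fin expR_ge0.
- apply/measurable_EFinP; apply: measurableT_comp => //; exact: measurable_funM.
(* completing the square *)
have tilt x : expR (t * x) * normal_pdf m s x =
    expR (t * m + t ^+ 2 * s ^+ 2 / 2) * normal_pdf (m + t * s ^+ 2) s x.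
  rewrite !normal_pdfE// mulrCA [RHS]mulrCA; congr (_ * _).
  rewrite /normal_fun -!expRD; congr expR.
  by rewrite -mulr_natl; field; rewrite s0.
under eq_integral do rewrite -EFinM tilt EFinM.
rewrite ge0_integralZl_EFin//.
- by rewrite integral_normal_pdf mule1.
- by move=> x _; rewrite lee_fin normal_pdf_ge0.
- by apply/measurable_EFinP; exact: measurable_normal_pdf.
Qed.

End NormalMGF.

(** * Linearity of the integral with integrability carried along *)

Section HasRintegral.
Context d (T : measurableType d) (R : realType) (P : probability T R).
Implicit Types (f g : T -> R) (a b k : R).

(** Pairing the value with integrability lets the rules for sums and scalings be chained without
    separate side conditions. *)
Definition has_Rintegral f a :=
  P.-integrable [set: T] (EFin \o f) /\ (\int[P]_x f x)%R = a.

Lemma has_Rintegral_cst k : has_Rintegral (fun=> k) k.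
Proof.
split; last by rewrite Rintegral_cst//= probability_setT /= mulr1.
exact: finite_measure_integrable_cst.
Qed.

Lemma has_RintegralD f g a b : has_Rintegral f a -> has_Rintegral g b ->
  has_Rintegral (fun x => f x + g x) (a + b).
Proof.
move=> [fi <-] [gi <-]; split; last by rewrite RintegralD.
rewrite (_ : _ \o _ = fun x => ((EFin \o f) x + (EFin \o g) x)%E) //.
exact: integrableD.
Qed.

Lemma has_RintegralZ k f a : has_Rintegral f a ->
  has_Rintegral (fun x => k * f x) (k * a).
Proof.
move=> [fi <-]; split; last by rewrite RintegralZl.
rewrite (_ : _ \o _ = fun x => (k%:E * (EFin \o f) x)%E) //.
exact: integrableZl.
Qed.

Lemma has_Rintegral_sum (I : Type) (r : seq I) (f : I -> T -> R) (a : I -> R) :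
  (forall i, has_Rintegral (f i) (a i)) ->
  has_Rintegral (fun x => \sum_(i <- r) f i x) (\sum_(i <- r) a i).
Proof.
move=> fa; elim: r => [|i r IHr].
  rewrite big_nil; under [X in has_Rintegral X _]eq_fun do rewrite big_nil.
  exact: has_Rintegral_cst.
rewrite big_cons; under [X in has_Rintegral X _]eq_fun do rewrite big_cons.
exact: has_RintegralD.
Qed.

End HasRintegral.

(** * Integrals of quadratic functions under finite second moments *)

Section SecondMoments.
Context {R : realType} {n : nat}.
Implicit Types (x a q : 'cV[R]_n) (P M : 'M[R]_n).
Implicit Types nu : probability (borelV R n) R.

Local Notation toV := (fun x : borelV R n => x : 'cV[R]_n).

Lemma measurable_coord i :
  measurable_fun [set: borelV R n] ((fun x => toV x i 0) : borelV R n -> R).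
Proof.
apply: (measurability _ (RGenOpens.measurableE R)) => _ [_ [a [b ->] <-]].
rewrite setTI; apply: sub_sigma_algebra; apply: open_comp.
  by move=> x _; exact: coord_continuous.
exact: interval_open.
Qed.

Lemma measurable_dotv a :
  measurable_fun [set: borelV R n] (dotv a : borelV R n -> R).
Proof.
rewrite (_ : dotv a = fun x => \sum_i a i 0 * x i 0); last first.
  by apply/funext => x; exact: dotvE.
apply: measurable_sum => i; apply: measurable_funM => //; exact: measurable_coord.
Qed.

Lemma measurable_qform M :
  measurable_fun [set: borelV R n] (qform M : borelV R n -> R).
Proof.
rewrite (_ : qform M = fun x => \sum_i \sum_j M i j * (x i 0 * x j 0)); last first.
  by apply/funext => x; exact: qformE.
apply: measurable_sum => i; apply: measurable_sum => j.
apply: measurable_funM => //; apply: measurable_funM; exact: measurable_coord.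
Qed.

Lemma measurable_quadratic P q r :
  measurable_fun [set: borelV R n] (quadratic P q r : borelV R n -> R).
Proof.
apply: measurable_funD => //; apply: measurable_funD.
  exact: measurable_qform.
exact: measurable_dotv.
Qed.

Lemma sqr_coord_le x i : x i 0 ^+ 2 <= dotv x x.
Proof.
rewrite dotvE (bigD1 i)//= expr2 lerDl.
by apply: sumr_ge0 => j _; rewrite -expr2 sqr_ge0.
Qed.

Lemma norm_coordM_le x i j : `|x i 0 * x j 0| <= dotv x x.
Proof.
have := sqr_coord_le x i; have := sqr_coord_le x j.
have := sqr_ge0 (`|x i 0| - `|x j 0|).
rewrite sqrrB !real_normK ?num_real// normrM.
by rewrite -mulr_natl; lra.
Qed.

Lemma norm_coord_le x i : `|x i 0| <= 1 + dotv x x.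
Proof.
have := sqr_coord_le x i; have := sqr_ge0 (`|x i 0| - 1).
have := normr_ge0 (x i 0).
rewrite sqrrB !real_normK ?num_real// -mulr_natl.
lra.
Qed.

(** Each [|x_i x_j|] and each [|x_i|] is at most [1 + dotv x x], so the sum of the absolute values
    of all coefficients serves as growth constant. *)
Lemma quadratics_quad_growth : @quadratics R n `<=` @quad_growth R n.
Proof.
move=> _ [P [q [r [_ ->]]]]; split; first exact: measurable_quadratic.
exists (\sum_i \sum_j `|P i j| + \sum_i `|q i 0| + `|r|) => x.
have dx0 := dotv_ge0 x; rewrite !mulrDl.
apply: (le_trans (ler_normD _ _)); apply: lerD; last first.
  by rewrite ler_peMr// lerDl.
apply: (le_trans (ler_normD _ _)); apply: lerD.
  rewrite qformE mulr_suml; apply: (le_trans (ler_norm_sum _ _ _)).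
  apply: ler_sum => i _; rewrite mulr_suml; apply: (le_trans (ler_norm_sum _ _ _)).
  apply: ler_sum => j _; rewrite normrM ler_wpM2l//.
  by apply: (le_trans (norm_coordM_le x i j)); rewrite lerDr.
rewrite dotvE mulr_suml; apply: (le_trans (ler_norm_sum _ _ _)).
by apply: ler_sum => i _; rewrite normrM ler_wpM2l// norm_coord_le.
Qed.

Definition moment2 nu : 'M[R]_n :=
  \matrix_(i, j) (\int[nu]_x (toV x i 0 * toV x j 0))%R.

Section FiniteSecondMoments.
Variable nu : probability (borelV R n) R.
Hypothesis hnu : finite_second_moments nu.

(** A single integrable majorant for all coordinates and all their pairwise products. *)
Let integrable_bound : nu.-integrable [set: borelV R n]
  (fun x => (1 + dotv (toV x) (toV x))%:E).
Proof.
have m_dotv : measurable_fun [set: borelV R n]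
    ((fun x => dotv (toV x) (toV x)) : borelV R n -> R).
  under eq_fun do rewrite dotvE.
  apply: measurable_sum => i; apply: measurable_funM; exact: measurable_coord.
under eq_fun do rewrite EFinD.
apply: integrableD => //; first exact: finite_measure_integrable_cst.
apply/integrableP; split; first exact/measurable_EFinP.
by under eq_integral do rewrite gee0_abs ?lee_fin ?dotv_ge0//.
Qed.

Lemma has_Rintegral_coord i :
  has_Rintegral nu (fun x => toV x i 0) (meanV nu i 0).
Proof.
split; last by rewrite mxE.
apply: le_integrable integrable_bound => //.
  by apply/measurable_EFinP; exact: measurable_coord.
move=> x _; rewrite /= lee_fin.
by apply: le_trans (ler_norm _); exact: norm_coord_le.
Qed.

Lemma has_Rintegral_coordM i j :
  has_Rintegral nu (fun x => toV x i 0 * toV x j 0) (moment2 nu i j).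
Proof.
split; last by rewrite mxE.
apply: le_integrable integrable_bound => //.
  by apply/measurable_EFinP; apply: measurable_funM; exact: measurable_coord.
move=> x _; rewrite /= lee_fin.
apply: le_trans (ler_norm _); apply: le_trans (norm_coordM_le _ _ _) _.
by rewrite lerDr.
Qed.

Lemma has_Rintegral_dotv a : has_Rintegral nu (dotv a) (dotv a (meanV nu)).
Proof.
rewrite (_ : dotv a = fun x => \sum_i a i 0 * x i 0); last first.
  by apply/funext => x; exact: dotvE.
by apply: has_Rintegral_sum => i; apply/has_RintegralZ/has_Rintegral_coord.
Qed.

Lemma has_Rintegral_qform M : has_Rintegral nu (qform M) (\tr (M *m moment2 nu)).
Proof.
(* The factors are swapped so that entry [(j, i)] of [moment2] appears, as in the trace of a
   product. *)
rewrite (_ : qform M = fun x => \sum_i \sum_j M i j * (x j 0 * x i 0)); last first.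
  apply/funext => x; rewrite qformE; apply: eq_bigr => i _.
  by apply: eq_bigr => j _; rewrite (mulrC (x i 0)).
apply: has_Rintegral_sum => i; rewrite mxE; apply: has_Rintegral_sum => j.
exact/has_RintegralZ/has_Rintegral_coordM.
Qed.

Lemma Rintegral_quadratic P q r :
  (\int[nu]_x quadratic P q r x)%R = \tr (P *m moment2 nu) + dotv q (meanV nu) + r.
Proof.
have [] : has_Rintegral nu (quadratic P q r)
    (\tr (P *m moment2 nu) + dotv q (meanV nu) + r).
  apply: has_RintegralD; last exact: has_Rintegral_cst.
  by apply: has_RintegralD; [exact: has_Rintegral_qform|exact: has_Rintegral_dotv].
by [].
Qed.

Lemma moment2_cov : moment2 nu = covV nu + meanV nu *m (meanV nu)^T.
Proof.
apply/matrixP => i j; rewrite [RHS]mxE.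
set mi := meanV nu i 0; set mj := meanV nu j 0.
have -> : (meanV nu *m (meanV nu)^T) i j = mi * mj.
  by rewrite mxE big_ord1 [(meanV nu)^T _ _]mxE.
have -> : covV nu i j = moment2 nu i j + - mj * mi + - mi * mj + mi * mj.
  rewrite [LHS]mxE -/mi -/mj.
  rewrite (_ : (fun x => _) = fun x => toV x i 0 * toV x j 0
      + - mj * toV x i 0 + - mi * toV x j 0 + mi * mj); last first.
    by apply/funext => x; ring.
  apply: (proj2 (has_RintegralD (has_RintegralD (has_RintegralD
    (has_Rintegral_coordM i j) (has_RintegralZ (- mj) (has_Rintegral_coord i)))
    (has_RintegralZ (- mi) (has_Rintegral_coord j))) (has_Rintegral_cst _ _))).
by ring.
Qed.

End FiniteSecondMoments.

(** * Mean and second moments of a Gaussian law on [R^n] *)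

Section Gaussian.
Variables (nu : probability (borelV R n) R) (mu : 'cV[R]_n) (W : 'M[R]_n).
Hypotheses (pW : psd W) (gnu : gaussian_law nu mu W).

Let dotv_delta i x : dotv (delta_mx i 0) x = x i 0.
Proof. by rewrite dotvC /dotv -colE !mxE. Qed.

(** The image of the law under [dotv a] is univariate normal by definition, so its generating
    function is known. *)
Lemma gaussian_mgf a t : (\int[nu]_y (expR (t * dotv a y))%:E =
  (expR (t * dotv a mu + t ^+ 2 * qform W a / 2))%:E)%E.
Proof.
pose phi : borelV R n -> measurableTypeR R := dotv a.
pose f (z : measurableTypeR R) := (expR (t * z))%:E.
have mf : measurable_fun [set: measurableTypeR R] f.
  apply/measurable_EFinP; apply: measurableT_comp => //; exact: measurable_funM.
have mphi : measurable_fun [set: borelV R n] phi by exact: measurable_dotv.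
have f0 z : (0 <= f z)%E by rewrite lee_fin expR_ge0.
transitivity (\int[pushforward nu phi]_z f z)%E.
  by rewrite ge0_integral_pushforward.
(* [normal_law] is only a set function defined by cases; in each case it is replaced by an actual
   measure that agrees with it. *)
have lawE (m : {measure set (measurableTypeR R) -> \bar R}) :
    (forall E, measurable E -> normal_law (dotv a mu) (qform W a) E = m E) ->
    (\int[pushforward nu phi]_z f z = \int[m]_z f z)%E.
  by move=> h; apply: eq_measure_integral => E mE _; rewrite -h// -gnu.
have [s0|s0] := eqVneq (qform W a) 0.
  rewrite (lawE (@dirac _ (measurableTypeR R) (dotv a mu) R)); last first.
    by move=> E mE; rewrite /normal_law s0 eqxx.
  by rewrite integral_dirac// diracT mul1e /f s0 mulr0 mul0r addr0.
rewrite (lawE (normal_prob (dotv a mu) (Num.sqrt (qform W a)))); last first.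
  by move=> E mE; rewrite /normal_law (negbTE s0).
have qW := pW.2 a.
rewrite integral_expR_normal_prob; last first.
  by rewrite sqrtr_eq0 -ltNge lt_neqAle eq_sym s0.
by rewrite sqr_sqrtr.
Qed.

(** [gaussian_law] assumes no integrability; it comes from the generating function, one coordinate
    at a time. *)
Lemma gaussian_finite_second_moments : finite_second_moments nu.
Proof.
pose v i := (\int[nu]_x (dotv (delta_mx i 0) (toV x) ^+ 2))%R.
have [/(integrable_lty measurableT)] :
    has_Rintegral nu (fun x => dotv (toV x) (toV x)) (\sum_i v i).
  rewrite (_ : (fun x => _) = fun x => \sum_i dotv (delta_mx i 0) (toV x) ^+ 2).
    apply: has_Rintegral_sum => i; split=> //.
    exact: (mgf_integrable (measurable_dotv _) (gaussian_mgf _)).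
  apply/funext => x; rewrite dotvE.
  by apply: eq_bigr => i _; rewrite dotv_delta expr2.
by [].
Qed.

Lemma gaussian_mean : meanV nu = mu.
Proof.
apply/matrixP => i j; rewrite ord1 mxE.
rewrite -dotv_delta -(mgf_moment1 (measurable_dotv _) (gaussian_mgf _)).
by apply: eq_Rintegral => x _; rewrite dotv_delta.
Qed.

(** Both sides are symmetric, so it suffices to compare their forms at each [a], where both equal
    the second moment of [dotv a]. *)
Lemma gaussian_moment2 : moment2 nu = W + mu *m mu^T.
Proof.
apply: symm_qform_inj.
- by apply/matrixP => i j; rewrite !mxE; apply: eq_Rintegral => x _; rewrite mulrC.
- by rewrite /symm linearD /= trmx_mul trmxK pW.1.
move=> a; rewrite qformD qform_outer dotvC.
rewrite -(mgf_moment2 (measurable_dotv a) (gaussian_mgf a)) qform_trace mxtrace_mulC.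
have [_ <-] := has_Rintegral_qform gaussian_finite_second_moments (a *m a^T).
by apply: eq_Rintegral => x _; rewrite qform_outer.
Qed.

End Gaussian.

End SecondMoments.

Theorem proposition3 (R : realType) (n m p : nat)
    (A : 'M[R]_n) (B : 'M[R]_(n, m)) (C : 'M[R]_(p, n)) (W : 'M[R]_n)
    (Q0 : 'M[R]_n) (R0 : 'M[R]_m) (alpha : R)
    (nu0 : probability (borelV R n) R)
    (tau : 'cV[R]_n -> 'cV[R]_m -> probability (borelV R n) R)
    (m0 : 'cV[R]_n) (Sigma0 : 'M[R]_n)
    (hW : psd W)
    (hQ0 : Q0 = C^T *m C) (hR0 : pd R0)
    (hAB : controllable A B) (hAC : observable A C)
    (halpha : 0 < alpha < 1)
    (hnu0 : finite_second_moments nu0)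
    (hm0 : m0 = meanV nu0) (hSigma0 : Sigma0 = covV nu0)
    (htau : forall x u, gaussian_law (tau x u) (A *m x + B *m u) W) :
  [/\ (* on quadratic functions, (D-SC) is (D-LQG) *)
      forall (P : 'M[R]_n) (q : 'cV[R]_n) (r : R), symm P ->
        (dsc_feasible tau Q0 R0 alpha (quadratic P q r) <->
         dlqg_feasible A B W Q0 R0 alpha P q r) /\
        dsc_obj nu0 (quadratic P q r) = dlqg_obj m0 Sigma0 P q r,
      (* hence (D-LQG) is the restriction of (D-SC) to quadratic functions *)
      (@quadratics R n `<=` @quad_growth R n) /\
      dsc_value tau nu0 Q0 R0 alpha (@quadratics R n) =
        dlqg_value A B W m0 Sigma0 Q0 R0 alpha /\
      (dlqg_value A B W m0 Sigma0 Q0 R0 alpha <=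
        dsc_value tau nu0 Q0 R0 alpha (@quad_growth R n))%E
    & (* (D-LQG) is the Lagrangian dual of (P-LQG) *)
      (forall (P : 'M[R]_n) (q : 'cV[R]_n) (r : R), symm P ->
        (dlqg_feasible A B W Q0 R0 alpha P q r ->
           plqg_dual A B W m0 Sigma0 Q0 R0 alpha P q r =
             (dlqg_obj m0 Sigma0 P q r)%:E) /\
        (~ dlqg_feasible A B W Q0 R0 alpha P q r ->
           plqg_dual A B W m0 Sigma0 Q0 R0 alpha P q r = -oo%E)) /\
      plqg_dual_value A B W m0 Sigma0 Q0 R0 alpha =
        dlqg_value A B W m0 Sigma0 Q0 R0 alpha].
Proof.
have sQ : symm Q0 by rewrite hQ0 /symm trmx_mul trmxK.
have sR : symm R0 by case: hR0.
have feasE P q r : symm P -> dsc_feasible tau Q0 R0 alpha (quadratic P q r) <->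
    dlqg_feasible A B W Q0 R0 alpha P q r.
  move=> sP.
  (* The expectation of [v] at the next state is [\tr (P *m W)] plus [v] at the mean successor
     state. *)
  have slackE x u : cost0 Q0 R0 x u - Tstar tau alpha (quadratic P q r) x u =
      qform (dlqg_mx A B W Q0 R0 alpha P q r) (col_mx 1%:M (col_mx x u)).
    rewrite qform_dlqg// /Tstar Rintegral_quadratic; last first.
      exact: gaussian_finite_second_moments (htau x u).
    rewrite (gaussian_mean hW (htau x u)) (gaussian_moment2 hW (htau x u)).
    rewrite [quadratic P q r (A *m x + _)]/quadratic.
    rewrite [qform P (A *m x + _)]qform_trace.
    by rewrite mulmxDr mxtraceD !addrA.
  split=> [[_ fv]|[_ [_ pM]]].
    split=> //; apply: psd_homogenize; first exact: symm_dlqg_mx.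
    by move=> y; rewrite -[y]vsubmxK -slackE.
  split=> [|x u]; last by rewrite slackE.
  by apply: quadratics_quad_growth; exists P, q, r.
have objE P q r : dsc_obj nu0 (quadratic P q r) = dlqg_obj m0 Sigma0 P q r.
  rewrite /dsc_obj Rintegral_quadratic// moment2_cov// -hm0 -hSigma0.
  by rewrite /dlqg_obj mulmxDr mxtraceD mulmxA.
have valueE : dsc_value tau nu0 Q0 R0 alpha (@quadratics R n) =
    dlqg_value A B W m0 Sigma0 Q0 R0 alpha.
  congr ereal_sup; apply/seteqP; split=> [_ [v [[P [q [r [sP ->]]]] fv] <-]|].
    by exists P, q, r; rewrite objE; split=> //; apply/feasE.
  move=> _ [P [q [r [[sP pM] ->]]]]; exists (quadratic P q r); last by rewrite objE.
  by split; [exists P, q, r|apply/feasE].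
split; first by move=> P q r sP; split; [exact: feasE|exact: objE].
  split; first exact: quadratics_quad_growth.
  split=> //; rewrite -valueE; apply: ereal_sup_le => _ [v [Qv fv] <-].
  by exists v => //; split=> //; exact: quadratics_quad_growth.
split=> [P q r sP|].
  by split; [exact: plqg_dual_feasible|exact: plqg_dual_infeasible].
(* Infeasible multipliers have dual value [-oo] and so do not affect the supremum; feasible ones
   have the same value in both programs. *)
apply/eqP; rewrite eq_le; apply/andP; split; apply/ereal_supP => e.
  move=> [P [q [r [sP ->]]]].
  have [F|nF] := pselect (dlqg_feasible A B W Q0 R0 alpha P q r); last first.
    by rewrite plqg_dual_infeasible// leNye.
  by rewrite plqg_dual_feasible//; apply: ereal_sup_ubound; exists P, q, r.
move=> [P [q [r [F ->]]]]; rewrite -(plqg_dual_feasible m0 Sigma0 F).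
by apply: ereal_sup_ubound; exists P, q, r; split=> //; case: F.
Qed.
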